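(* Let $n,a,k\ge 1$ be integers and let $\vec p=(p_1,\dots,p_a)$ be a probability vector. The expected number of inversions of a permutation distributed according to the $k$-fold convolution of the biased $a$-shuffle measure $P_{n,a;\vec p}$ on $S_n$ is $$\frac{\binom n2}{2}\left[1-(p_1^2+\cdots+p_a^2)^k\right].$$
   Context: Probability vector: real $p_i\ge 0$ with $\sum_{i=1}^a p_i=1$. The number of inversions of $\pi$ is the number of pairs $i<j$ with $\pi(i)>\pi(j)$. Descents: $\pi\in S_n$ has a descent at position $i$ ($1\le i\le n-1$) if $\pi(i)>\pi(i+1)$; by convention every $\pi\in S_n$ also has a descent at position $n$. The descent set of $\pi$ is the set of positions at which it has a descent. The measure $P_{n,a;\vec p}$ on $S_n$ (biased riffle shuffle): first choose $(b_1,\dots,b_a)$, $b_i\ge 0$, $b_1+\cdots+b_a=n$, with probability $\binom{n}{b_1\cdots b_a}\prod_{i=1}^a p_i^{b_i}$; then choose uniformly one of the $\binom{n}{b_1\cdots b_a}$ permutations $\pi\in S_n$ such that the descent set of $\pi^{-1}$ is contained in $\{b_1,b_1+b_2,\dots,b_1+\cdots+b_a=n\}$. The $k$-fold convolution of a measure $P$ on $S_n$ is the law of a product of $k$ independent permutations each with law $P$. *)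

(* Defs.v *)
From mathcomp Require Import all_boot all_order all_algebra all_fingroup.

Set Implicit Arguments.
Unset Strict Implicit.
Unset Printing Implicit Defensive.

Import Order.TTheory GRing.Theory Num.Theory.
Local Open Scope ring_scope.

(* The mathematical positions 1, ..., n are represented by 'I_n: the ordinal
   [i] stands for position [i.+1]. *)

Definition inversions (n : nat) (s : 'S_n) : {set 'I_n * 'I_n} :=
  [set ij : 'I_n * 'I_n | (ij.1 < ij.2)%N && (s ij.2 < s ij.1)%N].

(* By convention the last position [n] is always a descent. *)
Definition descent_set (n : nat) (s : 'S_n) : {set 'I_n} :=
  [set i : 'I_n | (i.+1 == n)
           || [exists j : 'I_n, (j == i.+1 :> nat) && (s j < s i)%N]].

(* The positions b_1 + ... + b_r for 1 <= r <= a; a partial sum equal to 0 is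
   not a position and is dropped. *)
Definition partial_sums (n a : nat) (b : {ffun 'I_a -> 'I_n.+1}) : {set 'I_n} :=
  [set i : 'I_n | [exists r : 'I_a, i.+1 == (\sum_(j < a | (j <= r)%N) b j)%N]].

(* Weak compositions of n into a parts; every part is at most n, hence the
   finite codomain. *)
Definition compositions (n a : nat) : {set {ffun 'I_a -> 'I_n.+1}} :=
  [set b : {ffun 'I_a -> 'I_n.+1} | (\sum_(j < a) b j)%N == n].

Definition multinomial (n a : nat) (b : {ffun 'I_a -> 'I_n.+1}) : nat :=
  (n`! %/ \prod_(j < a) (b j)`!)%N.

Definition shuffles_of (n a : nat) (b : {ffun 'I_a -> 'I_n.+1}) : {set 'S_n} :=
  [set s | descent_set s^-1%g \subset partial_sums b].

Definition uniform (R : realFieldType) (T : finType) (A : {set T}) (x : T) : R :=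
  if x \in A then #|A|%:R^-1 else 0.

Definition probability_vector (R : realFieldType) (a : nat) (p : 'I_a -> R) :
    Prop :=
  (forall i, 0 <= p i) /\ \sum_(i < a) p i = 1.

(* Measures on 'S_n are given by their point masses. *)
Definition biased_shuffle (R : realFieldType) (n a : nat) (p : 'I_a -> R)
    (s : 'S_n) : R :=
  \sum_(b in compositions n a)
    ((multinomial b)%:R * \prod_(i < a) p i ^+ b i) * uniform R (shuffles_of b) s.

(* The product is that of the group 'S_n, in which [(s * t) x = t (s x)].  The
   factors being i.i.d., the opposite order of composition gives the same law. *)
Definition convolution_power (R : realFieldType) (n : nat) (P : 'S_n -> R)
    (k : nat) (s : 'S_n) : R :=
  \sum_(t : {ffun 'I_k -> 'S_n} | (\prod_(i < k) t i)%g == s) \prod_(i < k) P (t i).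

Definition expectation (R : realFieldType) (n : nat) (P : 'S_n -> R)
    (X : 'S_n -> R) : R :=
  \sum_(s : 'S_n) P s * X s.

(* Main.v *)
(* A biased shuffle is the stable sorting permutation of a random
   word of n independent letters with law p: the words with b_j letters j
   correspond bijectively to the permutations with descents of the inverse in
   {b_1, b_1 + b_2, ...}, and their number is the multinomial coefficient.
   Follow a fixed permutation s by an independent shuffle t.  Two positions
   holding equal letters, an event of probability q = sum p_j^2, keep their
   relative order, and otherwise each order is equally likely; hence
   E[inv (s * t)] = binom(n, 2) (1 - q) / 2 + q inv s.  Solving this affine
   recursion in the number of shuffles, from inv 1 = 0, gives the formula. *)

Require Import Defs.
From mathcomp Require Import all_boot all_order all_algebra all_fingroup.
From mathcomp Require Import zify ring.
Import Order.TTheory GRing.Theory Num.Theory.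
Local Open Scope ring_scope.

Set Implicit Arguments.
Unset Strict Implicit.
Unset Printing Implicit Defensive.

(** * Counting words with prescribed letter multiplicities *)

Lemma sum_count_mem_undup (T : eqType) (s : seq T) :
  (\sum_(x <- undup s) count_mem x s)%N = size s.
Proof.
rewrite -sum1_size -(perm_big _ (perm_count_undup s)) big_flatten big_map.
by apply: eq_bigr => x _; rewrite big_nseq iter_addn_0 mul1n.
Qed.

Lemma size_permutations_count (T : finType) (s : seq T) :
  (size (permutations s) * \prod_(x : T) (count_mem x s)`!)%N = (size s)`!.
Proof.
have [n le_sn] := ubnP (size s); elim: n => // n IHn in s le_sn *.
have [/size0nil -> | s_gt0] := posnP (size s); first by rewrite /= big1.
rewrite (perm_size (permutationsE s_gt0)) size_allpairs_dep sumnE big_map.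
rewrite big_distrl /=.
transitivity (\sum_(x <- undup s) count_mem x s * (size s).-1`!)%N; last first.
  by rewrite -big_distrl /= sum_count_mem_undup -[in RHS](prednK s_gt0) factS prednK.
apply: eq_big_seq => x; rewrite mem_undup => xs.
rewrite -(size_rem xs) -IHn ?size_rem ?(leq_trans _ le_sn) ?prednK //.
rewrite mulnCA; congr (_ * _)%N.
rewrite (bigD1 x) //= [in RHS](bigD1 x) //= mulnA; congr (_ * _)%N.
  have /seq.permP/(_ (pred1 x)) /= := perm_to_rem xs.
  by rewrite eqxx add1n => ->; rewrite factS.
apply: eq_bigr => y /negPf yx.
have /seq.permP/(_ (pred1 y)) /= := perm_to_rem xs.
by rewrite eq_sym yx => ->.
Qed.

Definition words (n a : nat) (b : {ffun 'I_a -> 'I_n.+1}) :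
    {set {ffun 'I_n -> 'I_a}} :=
  [set w : {ffun 'I_n -> 'I_a} | [forall j, #|[set x | w x == j]| == b j]].

Lemma wordsP n a (b : {ffun 'I_a -> 'I_n.+1}) (w : {ffun 'I_n -> 'I_a}) :
  reflect (forall j, #|[set x | w x == j]| = b j) (w \in words b).
Proof. by rewrite inE; apply: (iffP forallP) => H j; apply/eqP. Qed.

Lemma count_mem_codom (n : nat) (T : finType) (w : {ffun 'I_n -> T}) j :
  count_mem j (codom w) = #|[set x | w x == j]|.
Proof.
by rewrite codomE count_map -sum1_count big_enum_cond /= -sum1dep_card.
Qed.

(** The words with content [b] are exactly the rearrangements of [w0]; the witness ensures that
    there is one to rearrange. *)
Lemma card_words n a (b : {ffun 'I_a -> 'I_n.+1}) (w0 : {ffun 'I_n -> 'I_a}) :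
  w0 \in words b -> #|words b| = multinomial b.
Proof.
move=> w0b; have sz (w : {ffun 'I_n -> 'I_a}) : size (codom w) = n.
  by rewrite size_codom card_ord.
have inj: injective (fun w : {ffun 'I_n -> 'I_a} => codom w).
  move=> w w' e; apply/ffunP => i.
  by rewrite -(nth_fgraph_ord (w i) i w) -codom_ffun e codom_ffun nth_fgraph_ord.
have eqp: perm_eq [seq codom w | w : {ffun 'I_n -> 'I_a} <- enum (words b)]
                  (permutations (codom w0)).
  apply: uniq_perm; rewrite ?permutations_uniq ?map_inj_uniq ?enum_uniq //.
  move=> t; rewrite mem_permutations; apply/mapP/idP.
    case=> w; rewrite mem_enum => /wordsP wb ->; apply/allP => j _ /=.
    by rewrite !count_mem_codom wb (wordsP _ _ w0b).
  move=> tw; have szt : size t == n by rewrite (perm_size tw) sz.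
  exists [ffun i => tnth (Tuple szt) i].
    rewrite mem_enum; apply/wordsP => j.
    rewrite -(wordsP _ _ w0b) -!count_mem_codom -(seq.permP tw).
    by rewrite codomE (eq_map (ffunE _)) map_tnth_enum.
  by rewrite codomE (eq_map (ffunE _)) map_tnth_enum.
have := size_permutations_count (codom w0).
rewrite -(perm_size eqp) size_map -cardE sz /multinomial => <-.
under eq_bigr do rewrite count_mem_codom (wordsP _ _ w0b).
by rewrite mulnK // prodn_gt0 // => j; rewrite fact_gt0.
Qed.

(** * Stable sorting permutations *)

(* The strict order on positions under which a stable sort of [w] lists them. *)
Definition before (n a : nat) (w : {ffun 'I_n -> 'I_a}) (x y : 'I_n) : bool :=
  ((w x < w y) || (w x == w y) && (x < y))%N.

Lemma before_irr n a (w : {ffun 'I_n -> 'I_a}) x : before w x x = false.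
Proof. by rewrite /before !ltnn andbF. Qed.

Lemma before_trans n a (w : {ffun 'I_n -> 'I_a}) : transitive (before w).
Proof. by move=> y x z; rewrite /before -!val_eqE /=; lia. Qed.

Lemma before_total n a (w : {ffun 'I_n -> 'I_a}) x y :
  x != y -> before w y x = ~~ before w x y.
Proof. by rewrite /before -!val_eqE /=; lia. Qed.

Lemma sort_rank_subproof n a (w : {ffun 'I_n -> 'I_a}) x :
  (#|[set y | before w y x]| < n)%N.
Proof.
rewrite -[X in (_ < X)%N]card_ord -cardsT proper_card //; apply/properP.
by split; [apply: subsetT | exists x; rewrite ?inE ?before_irr].
Qed.

Definition sort_rank n a (w : {ffun 'I_n -> 'I_a}) x : 'I_n :=
  Ordinal (sort_rank_subproof w x).

Lemma sort_rank_lt n a (w : {ffun 'I_n -> 'I_a}) x y :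
  (sort_rank w x < sort_rank w y)%N = before w x y.
Proof.
have mono u v : before w u v -> (sort_rank w u < sort_rank w v)%N.
  move=> uv; apply/proper_card/properP; split.
    by apply/subsetP => z; rewrite !inE => /before_trans; apply.
  by exists u; rewrite !inE ?before_irr.
have [<-|xy] := eqVneq x y; first by rewrite ltnn before_irr.
apply/idP/idP; last exact: mono.
by apply: contraTT; rewrite -before_total // -leqNgt => /mono /ltnW.
Qed.

Lemma sort_rank_inj n a (w : {ffun 'I_n -> 'I_a}) : injective (sort_rank w).
Proof.
move=> x y e; apply/eqP; apply/negPn/negP => xy.
by move: (before_total w xy); rewrite -!sort_rank_lt e ltnn.
Qed.

Definition stable_sort n a (w : {ffun 'I_n -> 'I_a}) : 'S_n :=
  perm (@sort_rank_inj n a w).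

Lemma stable_sort_lt n a (w : {ffun 'I_n -> 'I_a}) x y :
  (stable_sort w x < stable_sort w y)%N = before w x y.
Proof. by rewrite !permE sort_rank_lt. Qed.

Lemma val_perm_card n (s : 'S_n) x : val (s x) = #|[set y | (s y < s x)%N]|.
Proof.
rewrite -(card_imset _ (@perm_inj _ s)).
have -> : s @: [set y | (s y < s x)%N] = [set z : 'I_n | (z < s x)%N].
  apply/setP => z; rewrite inE; apply/imsetP/idP => [[y]|zx].
    by rewrite inE => ? ->.
  by exists ((s^-1)%g z); rewrite ?inE permKV.
rewrite -sum1dep_card (big_ord_narrow_cond (P := xpredT)) ?(ltnW (ltn_ord _)) //.
by rewrite sum1_card card_ord.
Qed.

(** A permutation is determined by the order it induces on positions, since each value is the number
    of smaller values. As [before w] is total, one implication already fixes that order. *)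
Lemma perm_before_unique n a (w : {ffun 'I_n -> 'I_a}) (s : 'S_n) :
  (forall x y, before w x y -> (s x < s y)%N) -> s = stable_sort w.
Proof.
move=> sP; apply/permP => x; apply/val_inj; rewrite val_perm_card permE /=.
apply/eq_card => y; rewrite !inE; have [->|yx] := eqVneq y x.
  by rewrite ltnn before_irr.
apply/idP/idP; last exact: sP.
by apply: contraTT; rewrite -before_total // -leqNgt => /sP /ltnW.
Qed.

(** * Blocks of consecutive values, and the bijection between words and shuffles *)

(** The index is a natural number so that [m = a] is allowed, which gives the end of the last block.
    Values are counted from 0, and block [r] runs from [block_start b r] up to but excluding
    [block_start b r.+1]. *)
Definition block_start n a (b : {ffun 'I_a -> 'I_n.+1}) (m : nat) : nat :=
  (\sum_(j < a | (j < m)%N) b j)%N.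

Lemma leq_block_start n a (b : {ffun 'I_a -> 'I_n.+1}) :
  {homo block_start b : m m' / (m <= m')%N}.
Proof.
move=> m m' mm'; rewrite /block_start [X in (_ <= X)%N](bigID (fun j : 'I_a => (j < m)%N)).
rewrite /= (eq_bigl (fun j : 'I_a => (j < m') && (j < m))%N) ?leq_addr // => j.
by rewrite andb_idl // => /leq_trans; apply.
Qed.

Lemma block_startS n a (b : {ffun 'I_a -> 'I_n.+1}) (r : 'I_a) :
  block_start b r.+1 = (block_start b r + b r)%N.
Proof.
rewrite /block_start (bigD1 r) //= addnC; congr (_ + _)%N.
by apply: eq_bigl => j; rewrite ltnS ltn_neqAle andbC.
Qed.

Lemma block_start_last n a (b : {ffun 'I_a -> 'I_n.+1}) m :
  b \in compositions n a -> (a <= m)%N -> block_start b m = n.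
Proof.
rewrite inE => /eqP bn am; rewrite -[RHS]bn; apply: eq_bigl => j.
exact: leq_trans am.
Qed.

Lemma in_partial_sums n a (b : {ffun 'I_a -> 'I_n.+1}) (i : 'I_n) :
  (i \in partial_sums b) = [exists r : 'I_a, i.+1 == block_start b r.+1].
Proof. by rewrite inE. Qed.

Definition in_block n a (b : {ffun 'I_a -> 'I_n.+1}) (r m : nat) : bool :=
  (block_start b r <= m < block_start b r.+1)%N.

Lemma in_block_le n a (b : {ffun 'I_a -> 'I_n.+1}) (r r' m m' : nat) :
  in_block b r m -> in_block b r' m' -> (m <= m')%N -> (r <= r')%N.
Proof.
move=> /andP[rm _] /andP[_ mr'] mm'; rewrite leqNgt; apply/negP => lt_r.
by have := leq_block_start b lt_r; lia.
Qed.

Lemma in_block_inj n a (b : {ffun 'I_a -> 'I_n.+1}) (r r' m : nat) :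
  in_block b r m -> in_block b r' m -> r = r'.
Proof.
by move=> rm r'm; apply/eqP; rewrite eqn_leq (in_block_le rm r'm) ?(in_block_le r'm rm).
Qed.

Lemma block_start_words n a (b : {ffun 'I_a -> 'I_n.+1}) w m :
  w \in words b -> block_start b m = #|[set x | (w x < m)%N]|.
Proof.
move=> /wordsP wb; rewrite -sum1dep_card.
rewrite (partition_big w (fun j : 'I_a => (j < m)%N)) //=.
apply: eq_bigr => j jm; rewrite -wb -sum1dep_card.
by apply: eq_bigl => x; rewrite andb_idl // => /eqP->.
Qed.

Lemma words_composition n a (b : {ffun 'I_a -> 'I_n.+1}) w :
  w \in words b -> b \in compositions n a.
Proof.
move=> wb; rewrite inE; apply/eqP; transitivity #|'I_n|; last exact: card_ord.
transitivity (block_start b a); first by apply: eq_bigl => j; rewrite ltn_ord.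
by rewrite (block_start_words _ wb); apply: eq_card => x; rewrite !inE ltn_ord.
Qed.

(** All smaller letters precede [x], and whatever precedes [x] has a letter at most [w x]; the
    latter inclusion is strict because [x] does not precede itself. *)
Lemma in_block_stable_sort n a (b : {ffun 'I_a -> 'I_n.+1}) w x :
  w \in words b -> in_block b (w x) (stable_sort w x).
Proof.
move=> wb; rewrite /in_block !(block_start_words _ wb) permE /=.
apply/andP; split.
  by apply/subset_leq_card/subsetP => y; rewrite !inE /before => ->.
apply/proper_card/properP; split; last by exists x; rewrite !inE ?before_irr.
by apply/subsetP => y; rewrite !inE /before -val_eqE /=; lia.
Qed.

(** The letter at [x] can be read off from the block that contains the image of [x]. *)
Lemma stable_sort_inj n a (b : {ffun 'I_a -> 'I_n.+1}) :
  {in words b &, injective (@stable_sort n a)}.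
Proof.
move=> w w' wb w'b e; apply/ffunP => x; apply/val_inj.
by have := in_block_stable_sort x wb; rewrite e => /in_block_inj; apply;
  apply: in_block_stable_sort.
Qed.

Lemma stable_sort_shuffle n a (b : {ffun 'I_a -> 'I_n.+1}) w :
  w \in words b -> stable_sort w \in shuffles_of b.
Proof.
move=> wb; rewrite inE; apply/subsetP => i; rewrite inE in_partial_sums.
set t := (_^-1)%g; have blk z : in_block b (w (t z)) z.
  by have := in_block_stable_sort (t z) wb; rewrite permKV.
case/orP => [/eqP i_n | /existsP[j /andP[/eqP ji tji]]].
  (* At the last position, the end of the block of [i] is squeezed between [i.+1] and [n]. *)
  apply/existsP; exists (w (t i)); have /andP[_ ilt] := blk i.
  have := leq_block_start b (ltn_ord (w (t i))).
  by rewrite eqn_leq ilt i_n (block_start_last (words_composition wb) (leqnn a)).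
(* Equal letters would be listed by increasing position, so a descent of [t] forces a larger letter
   at [t j]; hence the block of [i] ends exactly at [i.+1]. *)
have : before w (t i) (t j) by rewrite -stable_sort_lt !permKV ji.
rewrite /before -val_eqE /= (ltnNge (t i)) (ltnW tji) andbF orbF => lt_w.
apply/existsP; exists (w (t i)); have /andP[_ ilt] := blk i.
have /andP[jge _] := blk j; rewrite eqn_leq ilt -ji /=.
exact: leq_trans (leq_block_start b lt_w) jge.
Qed.

Lemma in_block_exists n a (b : {ffun 'I_a -> 'I_n.+1}) (m : 'I_n) :
  b \in compositions n a -> exists r : 'I_a, in_block b r m.
Proof.
move=> bn; have ex : exists r, (m < block_start b r.+1)%N.
  by exists a; rewrite (block_start_last bn).
case: (ex_minnP ex) => r mr rmin.
have ra : (r < a)%N.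
  case: a => [|a'] in b bn ex mr rmin *.
    by move: mr; rewrite /block_start big_ord0.
  by rewrite ltnS; apply: rmin; rewrite (block_start_last bn).
exists (Ordinal ra); rewrite /in_block /= mr andbT leqNgt.
case: r => [|r] in mr rmin ra *; first by rewrite [X in (_ < X)%N]big_pred0.
by apply/negP => /rmin; rewrite ltnn.
Qed.

(** A descent of the inverse can only occur at a partial sum, and these lie at the ends of blocks,
    never between two values of one block. The proof walks from [u] to [v] one step at a time. *)
Lemma shuffle_inv_increasing n a (b : {ffun 'I_a -> 'I_n.+1}) (s : 'S_n)
    (r : 'I_a) (u v : 'I_n) :
  s \in shuffles_of b -> in_block b r u -> in_block b r v -> (u <= v)%N ->
  ((s^-1)%g u <= (s^-1)%g v)%N.
Proof.
rewrite inE => /subsetP sub ru; move: v.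
suff H d (v : 'I_n) : v = (u + d)%N :> nat -> in_block b r v ->
    ((s^-1)%g u <= (s^-1)%g v)%N.
  by move=> v rv uv; apply: (H (v - u)%N); rewrite ?subnKC.
elim: d v => [|d IHd] v vE rv.
  by rewrite (_ : v = u) //; apply/val_inj; rewrite /= vE addn0.
have ltn : (u + d < n)%N by have := ltn_ord v; lia.
pose v' := Ordinal ltn; have rv' : in_block b r v'.
  by move: ru rv; rewrite /in_block /=; lia.
apply: leq_trans (IHd v' erefl rv') _; rewrite leqNgt; apply/negP => desc.
have /sub : v' \in descent_set s^-1%g.
  by rewrite inE; apply/orP; right; apply/existsP; exists v; rewrite desc vE addnS eqxx.
rewrite in_partial_sums => /existsP[r' /eqP /= r'E].
move: rv rv' => /andP[_]; rewrite vE addnS r'E => lt_r' /andP[/= le_r _].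
(* The partial sum found equals [v]. If [r' < r] it is at most the start of block [r], which is
   below [v]; otherwise it is at least the end of block [r], which is above [v]. *)
have [lt|le] := ltnP r' r.
  by have := leq_block_start b lt; lia.
have : (r.+1 <= r'.+1)%N by [].
by move/(leq_block_start b); lia.
Qed.

Lemma shuffle_stable_sort n a (b : {ffun 'I_a -> 'I_n.+1}) (s : 'S_n) :
  b \in compositions n a -> s \in shuffles_of b ->
  exists2 w, w \in words b & s = stable_sort w.
Proof.
move=> bn sb.
have /fin_all_exists[f fP] := fun m : 'I_n => in_block_exists m bn.
(* The letter at [x] is the index of the block that contains [s x]. *)
exists [ffun x => f (s x)].
  apply/wordsP => j.
  rewrite -(card_imset _ (@perm_inj _ s)).
  have -> : s @: [set x | [ffun x => f (s x)] x == j] = [set m : 'I_n | in_block b j m].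
    apply/setP => m; rewrite inE; apply/imsetP/idP => [[y]|jm].
      by rewrite inE ffunE => /eqP <- ->.
    exists ((s^-1)%g m); rewrite ?inE ?ffunE ?permKV //.
    by apply/eqP; apply: val_inj; apply: in_block_inj (fP m) jm.
  have le_n : (block_start b j.+1 <= n)%N.
    have := leq_block_start b (ltn_ord j).
    by rewrite (block_start_last bn (leqnn a)).
  rewrite -sum1dep_card /in_block.
  rewrite -(big_ord_widen_cond n (fun m => (block_start b j <= m)%N) (fun=> 1%N)) //.
  rewrite -(big_geq_mkord (block_start b j) _ xpredT (fun=> 1%N)).
  by rewrite sum_nat_const_nat muln1 block_startS addKn.
(* Different letters are compared through their blocks; equal letters through the monotonicity of
   the inverse on one block. *)
apply: perm_before_unique => x y; rewrite /before !ffunE.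
case/orP => [lt_f|/andP[/eqP e_f xy]].
  have /andP[_ ] := fP (s x); have /andP[le_y _] := fP (s y).
  by move/leq_trans; apply; apply: leq_trans le_y; apply: leq_block_start.
rewrite ltnNge; apply/negP => le_s.
have := shuffle_inv_increasing sb _ (fP (s x)) le_s.
by rewrite !permK e_f => /(_ (fP (s y))); rewrite leqNgt xy.
Qed.

Lemma shuffles_of_stable_sort n a (b : {ffun 'I_a -> 'I_n.+1}) :
  b \in compositions n a -> shuffles_of b = @stable_sort n a @: words b.
Proof.
move=> bn; apply/setP => s; apply/idP/imsetP => [|[w wb ->]].
  exact: shuffle_stable_sort.
exact: stable_sort_shuffle.
Qed.

(** * From the shuffle measure to independent letters *)

(** Each count is at most [n], so [inord] never falls back to its default value. *)
Definition word_content n a (w : {ffun 'I_n -> 'I_a}) : {ffun 'I_a -> 'I_n.+1} :=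
  [ffun j => inord #|[set x | w x == j]|].

Lemma in_words_content n a (b : {ffun 'I_a -> 'I_n.+1}) w :
  (w \in words b) = (word_content w == b).
Proof.
have le_n j : (#|[set x | w x == j]| < n.+1)%N.
  by rewrite ltnS -[X in (_ <= X)%N]card_ord max_card.
apply/wordsP/eqP => [wb|<- j]; last by rewrite ffunE inordK.
by apply/ffunP => j; rewrite ffunE -[RHS]inord_val -wb.
Qed.

Lemma prod_word_weight (R : comNzRingType) n a (p : 'I_a -> R)
    (b : {ffun 'I_a -> 'I_n.+1}) w :
  w \in words b -> \prod_(x < n) p (w x) = \prod_(j < a) p j ^+ b j.
Proof.
move=> /wordsP wb; rewrite (partition_big w xpredT) //=.
apply: eq_bigr => j _; rewrite -wb -prodr_const.
by apply: eq_big => x; [rewrite inE | move/eqP->].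
Qed.

(** Grouping words by content, the multinomial weight of [b] cancels the uniform mass on
    [shuffles_of b], and each shuffle keeps the weight of its unique word. *)
Lemma sum_biased_shuffle (R : realFieldType) n a (p : 'I_a -> R) (F : 'S_n -> R) :
  \sum_s biased_shuffle p s * F s =
  \sum_(w : {ffun 'I_n -> 'I_a}) (\prod_(x < n) p (w x)) * F (stable_sort w).
Proof.
rewrite /biased_shuffle; under eq_bigr do rewrite big_distrl /=.
rewrite exchange_big /=.
rewrite [RHS](partition_big (@word_content n a) (mem (compositions n a))) /=; last first.
  by move=> w _; apply: (@words_composition _ _ _ w); rewrite in_words_content.
apply: eq_bigr => b bn.
transitivity (\sum_(s in shuffles_of b) (\prod_(j < a) p j ^+ b j) * F s).
  rewrite [RHS]big_mkcond /=; apply: eq_bigr => s _; rewrite /uniform.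
  case: ifP => sb; last by rewrite mulr0 mul0r.
  (* This word serves both to evaluate the cardinal and to show that the cancelled multinomial is
     nonzero. *)
  have [w wb _] := shuffle_stable_sort bn sb.
  rewrite shuffles_of_stable_sort // card_in_imset; last exact: stable_sort_inj.
  rewrite (card_words wb) [_ * _ * _^-1]mulrAC divff ?mul1r // pnatr_eq0 -lt0n -(card_words wb).
  by apply/card_gt0P; exists w.
rewrite shuffles_of_stable_sort // big_imset /=; last exact: stable_sort_inj.
apply: eq_big => w; first by rewrite in_words_content.
by move=> /prod_word_weight ->.
Qed.

(** * The relative order of two positions *)

Lemma sum_word_pair (R : comNzRingType) n a (p : 'I_a -> R) (u v : 'I_n)
    (g : 'I_a -> 'I_a -> R) :
  \sum_(i < a) p i = 1 -> u != v ->
  \sum_(w : {ffun 'I_n -> 'I_a}) (\prod_(x < n) p (w x)) * g (w u) (w v) =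
  \sum_(c < a) \sum_(d < a) p c * p d * g c d.
Proof.
move=> p1 uv; rewrite pair_big /=.
rewrite (partition_big (fun w : {ffun 'I_n -> 'I_a} => (w u, w v)) xpredT) //=.
apply: eq_bigr => -[c d] _ /=.
under eq_bigr => w /eqP[-> ->] do [].
rewrite -big_distrl /=; congr (_ * _).
(* The constraint at [u] and [v] is stated coordinate by coordinate, so that the sum over words
   factors: coordinates [u] and [v] give [p c] and [p d], every other one gives total mass 1. *)
pose Q (x : 'I_n) (j : 'I_a) := ((x == u) ==> (j == c)) && ((x == v) ==> (j == d)).
transitivity (\prod_(x < n) \sum_(j < a | Q x j) p j).
  rewrite bigA_distr_big_dep; apply: eq_bigl => w /=.
  rewrite xpair_eqE; apply/andP/familyP => [[/eqP wu /eqP wv] x|wQ].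
    by apply/andP; split; apply/implyP => /eqP->; apply/eqP.
  have := wQ u; have := wQ v; rewrite -![_ \in _]/(Q _ _) /Q !eqxx.
  by move=> /andP[_ /= ->] /andP[/= ->].
rewrite (bigD1 u) //= (bigD1 v) 1?eq_sym //=.
rewrite [X in _ * (_ * X)]big1 => [|x /andP[/negPf xu /negPf xv]].
  rewrite mulr1; congr (_ * _); apply: big_pred1 => j.
    by rewrite /Q eqxx (negPf uv) andbT.
  by rewrite /Q eqxx eq_sym (negPf uv).
by rewrite -[RHS]p1; apply: eq_bigl => j; rewrite /Q xu xv.
Qed.

Lemma sum_pair_eq (R : comNzRingType) a (p : 'I_a -> R) :
  \sum_(c < a) \sum_(d < a) p c * p d * (d == c)%:R = \sum_(c < a) p c ^+ 2.
Proof.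
apply: eq_bigr => c _; rewrite (bigD1 c) //= eqxx mulr1 big1 ?addr0 ?expr2 //.
by move=> d /negPf->; rewrite mulr0.
Qed.

(** By symmetry both strict orders have the same weight, and together with the ties they exhaust the
    total mass 1. *)
Lemma sum_pair_lt (R : realFieldType) a (p : 'I_a -> R) :
  \sum_(i < a) p i = 1 ->
  \sum_(c < a) \sum_(d < a) p c * p d * (d < c)%N%:R =
  (1 - \sum_(c < a) p c ^+ 2) / 2%:R.
Proof.
move=> p1; set S := LHS.
have SE : S = \sum_(c < a) \sum_(d < a) p c * p d * (c < d)%N%:R.
  rewrite /S exchange_big /=; apply: eq_bigr => c _; apply: eq_bigr => d _.
  by rewrite (mulrC (p d)).
have total : S + S + \sum_(c < a) p c ^+ 2 = 1.
  transitivity ((\sum_(c < a) p c) * (\sum_(d < a) p d)); last by rewrite p1 mulr1.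
  rewrite {1}SE -sum_pair_eq big_distrlr /= -!big_split; apply: eq_bigr => c _ /=.
  rewrite -!big_split; apply: eq_bigr => d _ /=.
  by rewrite -!mulrDr -!natrD -val_eqE /=; case: ltngtP; rewrite mulr1.
by rewrite -[X in X - _]total addrK -mulr2n -(mulr_natr S) mulfK // pnatr_eq0.
Qed.

Lemma biased_shuffle_pair (R : realFieldType) n a (p : 'I_a -> R) (u v : 'I_n) :
  \sum_(i < a) p i = 1 -> u != v ->
  \sum_t biased_shuffle p t * (t v < t u)%N%:R =
  (1 - \sum_(c < a) p c ^+ 2) / 2%:R + (\sum_(c < a) p c ^+ 2) * (v < u)%N%:R.
Proof.
move=> p1 uv; rewrite sum_biased_shuffle.
(* Given letters [c] at [u] and [d] at [v], this is the indicator that [v] is sorted before [u]: a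
   smaller letter, or a tie with [v < u]. *)
pose g (c d : 'I_a) : R := (d < c)%N%:R + (d == c)%:R * (v < u)%N%:R.
transitivity (\sum_(w : {ffun 'I_n -> 'I_a}) (\prod_(x < n) p (w x)) * g (w u) (w v)).
  apply: eq_bigr => w _; rewrite stable_sort_lt /before /g -natrM -natrD -val_eqE /=.
  by rewrite mulnb; case: ltngtP; rewrite ?addn0.
rewrite (sum_word_pair g p1 uv) -sum_pair_lt // -sum_pair_eq big_distrl /=.
rewrite -big_split /=; apply: eq_bigr => c _.
rewrite big_distrl /= -big_split /=; apply: eq_bigr => d _.
by rewrite /g mulrDr mulrA.
Qed.

Lemma biased_shuffle_total (R : realFieldType) n a (p : 'I_a -> R) :
  \sum_(i < a) p i = 1 -> \sum_(s : 'S_n) biased_shuffle p s = 1.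
Proof.
move=> p1; have := sum_biased_shuffle p (fun _ : 'S_n => 1).
under eq_bigr do rewrite mulr1; move=> ->; under eq_bigr do rewrite mulr1.
by rewrite -(bigA_distr_bigA (fun _ => p)) /= big1.
Qed.

(** * Mean number of inversions after one more shuffle *)

Lemma natr_inversions (R : pzSemiRingType) n (s : 'S_n) :
  #|inversions s|%:R =
  \sum_(ij : 'I_n * 'I_n | (ij.1 < ij.2)%N) (s ij.2 < s ij.1)%N%:R :> R.
Proof.
rewrite /inversions -sum1dep_card natr_sum big_mkcondr /=.
by apply: eq_bigr => ij _; case: ifP.
Qed.

Lemma sum_ltn_pairs (R : pzSemiRingType) n (x : R) :
  \sum_(ij : 'I_n * 'I_n | (ij.1 < ij.2)%N) x = 'C(n, 2)%:R * x.
Proof.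
rewrite sumr_const -[LHS]mulr_natl; congr (_%:R * _).
rewrite -bin2_sum big_mkord -sum1_card.
rewrite -(pair_big_dep xpredT (fun i j : 'I_n => (i < j)%N) (fun _ _ => 1%N)) /=.
rewrite (exchange_big_dep xpredT) //=; apply: eq_bigr => j _.
rewrite (big_ord_narrow_cond (P := xpredT) (ltnW (ltn_ord j))).
by rewrite sum1_card card_ord.
Qed.

Lemma mean_inversions_mul (R : realFieldType) n a (p : 'I_a -> R) (s : 'S_n) :
  \sum_(i < a) p i = 1 ->
  \sum_t biased_shuffle p t * #|inversions (s * t)%g|%:R =
  'C(n, 2)%:R / 2%:R * (1 - \sum_(c < a) p c ^+ 2)
    + (\sum_(c < a) p c ^+ 2) * #|inversions s|%:R.
Proof.
move=> p1; under eq_bigr do rewrite natr_inversions big_distrr /=.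
rewrite exchange_big /= natr_inversions big_distrr /=.
(* The constant is spread over the ['C(n, 2)] pairs, leaving one identity per pair [i < j]: the
   two-position formula at [s i] and [s j]. *)
rewrite mulrAC -mulrA -sum_ltn_pairs -big_split /=.
apply: eq_bigr => -[i j] /= ij.
under eq_bigr do rewrite !permM.
by rewrite biased_shuffle_pair // (inj_eq perm_inj) -val_eqE /=; lia.
Qed.

(** * Convolution powers and the affine recursion *)

Lemma expectation_convolution (R : realFieldType) n (P : 'S_n -> R) k X :
  expectation (convolution_power P k) X =
  \sum_(t : {ffun 'I_k -> 'S_n}) (\prod_(i < k) P (t i)) * X (\prod_(i < k) t i)%g.
Proof.
rewrite [RHS](partition_big (fun t : {ffun 'I_k -> 'S_n} => (\prod_(i < k) t i)%g) xpredT) //=.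
apply: eq_bigr => s _; rewrite /convolution_power big_distrl /=.
by apply: eq_bigr => t /eqP->.
Qed.

(** The new entry goes last, to match [big_ord_recr], which splits off the last factor of the
    product. *)
Definition ffun_rcons (T : Type) k (f : {ffun 'I_k -> T}) (x : T) :
    {ffun 'I_k.+1 -> T} :=
  [ffun i => if unlift ord_max i is Some j then f j else x].

Lemma ffun_rcons_widen (T : Type) k (f : {ffun 'I_k -> T}) x (i : 'I_k) :
  ffun_rcons f x (widen_ord (leqnSn k) i) = f i.
Proof.
rewrite ffunE (_ : widen_ord _ i = lift ord_max i) ?liftK //.
by apply: val_inj; rewrite [RHS]lift_max.
Qed.

Lemma ffun_rcons_max (T : Type) k (f : {ffun 'I_k -> T}) x :
  ffun_rcons f x ord_max = x.
Proof. by rewrite ffunE unlift_none. Qed.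

Lemma sum_ffun_recr (R : nmodType) (T : finType) k
    (F : {ffun 'I_k.+1 -> T} -> R) :
  \sum_f F f = \sum_(f : {ffun 'I_k -> T}) \sum_x F (ffun_rcons f x).
Proof.
rewrite pair_big /=.
rewrite (reindex (fun fx : {ffun 'I_k -> T} * T => ffun_rcons fx.1 fx.2)) //=.
exists (fun f => ([ffun i => f (widen_ord (leqnSn k) i)], f ord_max)).
  move=> [f x] _; rewrite /= ffun_rcons_max; congr (_, _).
  by apply/ffunP => i; rewrite ffunE ffun_rcons_widen.
move=> f _; apply/ffunP => i; rewrite /ffun_rcons ffunE /=.
case: unliftP => [j|] ->; rewrite ?ffunE //; congr (f _).
by apply: val_inj; rewrite [RHS]lift_max.
Qed.

(** Splitting off the last factor leaves a product [s] of [k] factors, independent of the final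
    shuffle [t]. *)
Lemma expectation_convolutionS (R : realFieldType) n (P : 'S_n -> R) k X :
  expectation (convolution_power P k.+1) X =
  expectation (convolution_power P k) (fun s => \sum_t P t * X (s * t)%g).
Proof.
rewrite !expectation_convolution sum_ffun_recr; apply: eq_bigr => f _.
rewrite big_distrr /=; apply: eq_bigr => t _.
rewrite !big_ord_recr /= !ffun_rcons_max mulrA.
by congr (_ * _ * X (_ * _)%g); apply: eq_bigr => i _; rewrite ffun_rcons_widen.
Qed.

Lemma expectation_affine (R : realFieldType) n (P X : 'S_n -> R) (c q : R) :
  expectation P (fun s => c + q * X s) = c * (\sum_s P s) + q * expectation P X.
Proof.
rewrite /expectation !big_distrr -big_split /=; apply: eq_bigr => s _.
by rewrite mulrDr mulrC mulrCA.
Qed.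

Lemma convolution_power_total (R : realFieldType) n (P : 'S_n -> R) k :
  \sum_s P s = 1 -> \sum_s convolution_power P k s = 1.
Proof.
move=> P1; have := expectation_convolution P k (fun=> 1).
rewrite /expectation; under eq_bigr do rewrite mulr1; move=> ->.
under eq_bigr do rewrite mulr1.
by rewrite -(bigA_distr_bigA (fun _ => P)) big1.
Qed.

Lemma inversions1 n : inversions (1 : 'S_n)%g = set0.
Proof.
by apply/setP => -[i j]; rewrite !inE !perm1 /= ltnNge; case: ltngtP.
Qed.

Unset Implicit Arguments.

Theorem theorem6 (R : realFieldType) (n a k : nat) (p : 'I_a -> R)
    (hn : (1 <= n)%N) (ha : (1 <= a)%N) (hk : (1 <= k)%N)
    (hp : probability_vector p) :
  expectation (convolution_power (biased_shuffle p) k)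
    (fun s : 'S_n => #|inversions s|%:R)
  = 'C(n, 2)%:R / 2%:R * (1 - (\sum_(i < a) p i ^+ 2) ^+ k).
Proof.
have [_ p1] := hp; clear hk; set q := \sum_(i < a) p i ^+ 2.
elim: k => [|k IHk].
  (* The induction starts at [k = 0]: the empty product is the identity, which has no inversions. *)
  rewrite expectation_convolution expr0 subrr mulr0; apply: big1 => t _.
  by rewrite [X in inversions X]big_ord0 inversions1 cards0 mulr0.
rewrite expectation_convolutionS.
have -> : expectation (convolution_power (biased_shuffle p) k)
    (fun s : 'S_n => \sum_t biased_shuffle p t * #|inversions (s * t)%g|%:R) =
  expectation (convolution_power (biased_shuffle p) k)
    (fun s : 'S_n => 'C(n, 2)%:R / 2%:R * (1 - q) + q * #|inversions s|%:R).
  by apply: eq_bigr => s _; rewrite mean_inversions_mul.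
(* The constant term survives unchanged because the convolution power has total mass 1. *)
rewrite expectation_affine convolution_power_total ?biased_shuffle_total // IHk exprS.
ring.
Qed.
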